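(* Let $0<x<1$ and $t>0$. Let $\phi=\{\phi(y):0\le y\le1\}$ be a stochastic process in $L^2(\Omega\times[0,1])$ and let $\alpha^2$ be a positive random variable. For $n\ge1$ let $A_n(\omega)=2\int_0^1\phi(y)(\omega)\sin(n\pi y)\,dy$. Suppose that, for every $N\ge2$, $\alpha^2$, $A_1$ and $(A_2,\ldots,A_N)$ are independent and absolutely continuous. Suppose that the probability density function $f_{A_1}$ is Lipschitz on $\mathbb R$. Assume that $\sum_{n=m}^\infty\|e^{-(n^2-2)\pi^2\alpha^2t}\|_{L^1(\Omega)}<\infty$ for certain $m\in\mathbb N$. Then the density of $u_N(x,t)(\omega)=\sum_{n=1}^NA_n(\omega)e^{-n^2\pi^2\alpha^2(\omega)t}\sin(n\pi x)$, namely $$f_{u_N(x,t)}(u)=\int_{\mathbb R^N}f_{A_1}\left(\frac{e^{\pi^2\alpha^2t}}{\sin(\pi x)}\left\{u-\sum_{n=2}^Na_ne^{-n^2\pi^2\alpha^2t}\sin(n\pi x)\right\}\right)f_{(A_2,\ldots,A_N)}(a_2,\ldots,a_N)\,f_{\alpha^2}(\alpha^2)\,\frac{e^{\pi^2\alpha^2t}}{\sin(\pi x)}\,da_2\cdots da_N\,d\alpha^2,$$ converges in $L^\infty(\mathbb R)$, as $N\to\infty$, to a density of the random variable $$u(x,t)(\omega)=\sum_{n=1}^\infty A_n(\omega)e^{-n^2\pi^2\alpha^2(\omega)t}\sin(n\pi x).$$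
   Context: All random objects live on a complete probability space $(\Omega,\mathcal F,\mathbb P)$. $L^2(\Omega\times[0,1])$ is the space of measurable $f$ on $\Omega\times[0,1]$ with $\mathbb E[\int_0^1|f(x)|^2dx]<\infty$; integrals defining $A_n$ are Lebesgue integrals for fixed $\omega$. $f_X$ denotes the probability density function of an absolutely continuous random vector $X$ (absolutely continuous with respect to Lebesgue measure); $f_{A_1}$ is the Lipschitz version of the density of $A_1$. The symbol $\alpha^2$ denotes the random variable and, inside integrals, also the real integration variable of its density $f_{\alpha^2}$. Convergence in $L^\infty(\mathbb R)$ means that the $L^\infty(\mathbb R)$-norm of the difference tends to $0$. *)

(* Defs.v *)
From HB Require Import structures.
From mathcomp Require Import all_boot all_order all_algebra.
From mathcomp Require Import all_classical all_reals all_analysis.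
From mathcomp Require Import measurable_realfun ess_sup_inf.

Set Implicit Arguments.
Unset Strict Implicit.
Unset Printing Implicit Defensive.

Import Order.TTheory GRing.Theory Num.Theory.
Import numFieldNormedType.Exports.

Local Open Scope classical_set_scope.
Local Open Scope ring_scope.

Section leb_tuple.
Context {R : realType}.
Local Open Scope ereal_scope.

Definition cons_pair n (z : measurableTypeR R * n.-tuple (measurableTypeR R)) :
    n.+1.-tuple (measurableTypeR R) :=
  [the n.+1.-tuple (measurableTypeR R) of z.1 :: z.2].

Lemma measurable_cons_pair n : measurable_fun [set: _] (@cons_pair n).
Proof. exact: measurable_cons. Qed.

Section leb_cons.
Variables (n : nat).
Variable m : {sigma_finite_measure set (n.-tuple (measurableTypeR R)) -> \bar R}.

Definition leb_cons : set (n.+1.-tuple (measurableTypeR R)) -> \bar R :=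
  pushforward (lebesgue_measure \x m) (@cons_pair n).

Let preim A : measurable A -> measurable (@cons_pair n @^-1` A).
Proof. by move=> mA; rewrite -[X in measurable X]setTI; exact: measurable_cons_pair. Qed.

Let leb_cons0 : leb_cons set0 = 0.
Proof. by rewrite /leb_cons /pushforward preimage_set0 measure0. Qed.

Let leb_cons_ge0 A : 0 <= leb_cons A.
Proof. exact: (measure_ge0 (lebesgue_measure \x m)). Qed.

Let leb_cons_sigma_additive : semi_sigma_additive leb_cons.
Proof.
move=> F mF tF mUF; rewrite /leb_cons /pushforward preimage_bigcup.
apply: measure_semi_sigma_additive.
- by move=> i; exact: preim.
- apply/trivIsetP => /= i j _ _ ij; rewrite -preimage_setI.
  by move/trivIsetP : tF => /(_ _ _ _ _ ij) ->//; rewrite preimage_set0.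
- by rewrite -preimage_bigcup; exact: preim.
Qed.

HB.instance Definition _ := isMeasure.Build _ _ _ leb_cons
  leb_cons0 leb_cons_ge0 leb_cons_sigma_additive.

Let leb_cons_sigma_finite : sigma_finite setT leb_cons.
Proof.
have /sigma_finiteP[F [FT ndF Foo]] := sigma_finiteT (@lebesgue_measure R).
have /sigma_finiteP[G [GT ndG Goo]] := sigma_finiteT m.
pose uncons (s : n.+1.-tuple (measurableTypeR R)) :=
  (thead s, [tuple of behead s]).
have muncons : measurable_fun setT uncons.
  apply/measurable_fun_pairP; split; first exact: measurable_tnth.
  exact: measurable_behead.
have unconsK : forall A, @cons_pair n @^-1` (uncons @^-1` A) = A.
  move=> A; rewrite -comp_preimage (_ : uncons \o _ = id)//.
  by rewrite funeqE => -[a s]; congr pair; exact: val_inj.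
exists (fun k => uncons @^-1` (F k `*` G k)).
  rewrite -preimage_bigcup -(preimage_setT uncons); congr (_ @^-1` _).
  rewrite predeqE => -[a s]; split=> // _.
  have [i _ Fi] : (\bigcup_i F i) a by rewrite -FT.
  have [j _ Gj] : (\bigcup_i G i) s by rewrite -GT.
  exists (maxn i j) => //; split.
  - by move: a Fi; exact/subsetPset/ndF/leq_maxl.
  - by move: s Gj; exact/subsetPset/ndG/leq_maxr.
move=> k; have [mF Fk] := Foo k; have [mG Gk] := Goo k; split.
  by rewrite -[X in measurable X]setTI; apply: muncons => //; exact: measurableX.
rewrite /leb_cons /pushforward unconsK.
by rewrite product_measure1E// lte_mul_pinfty// ge0_fin_numE.
Qed.

HB.instance Definition _ := Measure_isSigmaFinite.Build _ _ _ leb_cons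
  leb_cons_sigma_finite.
End leb_cons.

(* Lebesgue measure on R^n, where R^n.+1 is identified with R * R^n; on the
   one-point space R^0 it is the unit mass. *)
Fixpoint leb_tuple (n : nat) :
    {sigma_finite_measure set (n.-tuple (measurableTypeR R)) -> \bar R} :=
  match n with
  | 0 => \d_([tuple])
  | n'.+1 => leb_cons (leb_tuple n')
  end.

End leb_tuple.
Arguments leb_tuple {R} n.

Section probability_notions.
Context d (T : measurableType d) (R : realType) (P : probability T R).
Local Open Scope ereal_scope.

(* [X] is absolutely continuous with respect to [mu], with density [f]; a
   density may take the value +oo, necessarily on a [mu]-null set. *)
Definition is_density d' (T' : measurableType d')
    (mu : {measure set T' -> \bar R}) (X : T -> T') (f : T' -> \bar R) :=
  [/\ measurable_fun [set: T] X,
      measurable_fun [set: T'] f,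
      (forall y, 0 <= f y) &
      forall B, measurable B -> P (X @^-1` B) = \int[mu]_(y in B) f y].

(* Mutual independence of three random elements; pairwise independence is the
   special case where one of the sets is the whole space. *)
Definition independent3 d1 d2 d3 (T1 : measurableType d1)
    (T2 : measurableType d2) (T3 : measurableType d3)
    (X : T -> T1) (Y : T -> T2) (Z : T -> T3) :=
  forall A B C, measurable A -> measurable B -> measurable C ->
    P (X @^-1` A `&` Y @^-1` B `&` Z @^-1` C) =
    P (X @^-1` A) * P (Y @^-1` B) * P (Z @^-1` C).

(* Membership in L^2(Omega x [0,1]); [phi w y] is irrelevant for [y] outside
   [0,1]. *)
Definition L2_process (phi : T -> R -> R) :=
  measurable_fun ([set: T] `*` (`[0%R, 1%R]%classic : set (measurableTypeR R)))
    (fun z : T * measurableTypeR R => phi z.1 z.2) /\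
  \int[P]_w \int[lebesgue_measure]_(y in `[0%R, 1%R]) (`|phi w y| ^+ 2)%:E < +oo.

End probability_notions.

Section heat.
Context d (T : measurableType d) (R : realType).

Definition sine_coef (phi : T -> R -> R) (n : nat) (w : T) : R :=
  2 * \int[lebesgue_measure]_(y in `[0, 1]) (phi w y * sin (n%:R * pi * y)).

(* The random vector (A_2, ..., A_N): component [i] is A_(i+2). *)
Definition tail_vector (A : nat -> T -> R) (N : nat) (w : T) :
    N.-1.-tuple (measurableTypeR R) :=
  [tuple A i.+2 w | i < N.-1].

(* The factor e^(-n^2 pi^2 a t) sin(n pi x), where [a] stands for alpha^2. *)
Definition heat_mode (x t : R) (n : nat) (a : R) : R :=
  expR (- (n%:R ^+ 2 * pi ^+ 2 * a * t)) * sin (n%:R * pi * x).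

Definition heat_sum (x t : R) (alpha2 : T -> R) (A : nat -> T -> R) (N : nat)
    (w : T) : R :=
  \sum_(1 <= n < N.+1) A n w * heat_mode x t n (alpha2 w).

(* On the null set where the series diverges, [limn] returns a default value. *)
Definition heat_solution (x t : R) (alpha2 : T -> R) (A : nat -> T -> R)
    (w : T) : R :=
  limn (fun N => heat_sum x t alpha2 A N w).

End heat.

(* The integration variable is z = ((a_2, ..., a_N), alpha^2). *)
Definition heat_sum_density (R : realType) (x t : R) (N : nat)
    (fA1 : R -> R) (fA : N.-1.-tuple (measurableTypeR R) -> R) (falpha2 : R -> R)
    (u : R) : \bar R :=
  (\int[leb_tuple N.-1 \x lebesgue_measure]_z
    (fA1 (expR (pi ^+ 2 * z.2 * t) / sin (pi * x) *
          (u - \sum_(i < N.-1) tnth z.1 i * heat_mode x t i.+2 z.2)) *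
     fA z.1 * falpha2 z.2 * (expR (pi ^+ 2 * z.2 * t) / sin (pi * x)))%:E)%E.

(* Main.v *)
Require Import Defs.
From HB Require Import structures.
From mathcomp Require Import all_boot all_order all_algebra.
From mathcomp Require Import all_classical all_reals all_analysis.
From mathcomp Require Import measurable_realfun ess_sup_inf.
From mathcomp Require Import ring lra.

(* Write k = e^(pi^2 alpha^2 t) / sin(pi x) and let S_N be the part of u_N
   carried by A_2, ..., A_N.  Then u_N = A_1 / k + S_N is affine in A_1, which is
   independent of (alpha^2, A_2, ..., A_N), so that u_N has the density
   u |-> E[f_{A_1}(k (u - S_N)) k].  If L is a Lipschitz constant of f_{A_1}, two
   consecutive densities differ, uniformly in u, by at most
     L E[k^2 |S_{N+1} - S_N|]
       <= L / sin(pi x)^2 E|A_{N+1}| E[e^(-((N+1)^2 - 2) pi^2 alpha^2 t)].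
   Since |A_n| <= 2 (1 + int_0^1 phi^2), these bounds are summable and the
   densities converge uniformly, at the points where they are finite, to some g.
   Finally u_N -> u almost surely, and Fatou's lemma on bounded open intervals and
   on complements of compact ones shows that g is a density of u. *)

Import Order.TTheory GRing.Theory Num.Theory.
Import numFieldNormedType.Exports.

Local Open Scope classical_set_scope.
Local Open Scope ring_scope.

Set Implicit Arguments.
Unset Strict Implicit.
Unset Printing Implicit Defensive.

(** * Measures, densities and independence *)

Section measure_existence.
Local Open Scope ereal_scope.

(** A bundled measure is produced under an existential so that uniqueness and continuity results for
    measures apply to it. *)
Lemma exists_density_measure d (T : measurableType d) (R : realType)
    (mu : {measure set T -> \bar R}) (g : T -> \bar R) :
  measurable_fun setT g -> (forall y, 0 <= g y) ->
  exists nu : {measure set T -> \bar R}, forall A, nu A = \int[mu]_(y in A) g y.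
Proof.
move=> mg g0; pose nu (A : set T) := \int[mu]_(y in A) g y.
have nu0 : nu set0 = 0 by exact: integral_set0.
have nu_ge0 A : 0 <= nu A by exact: integral_ge0.
have nuS : semi_sigma_additive nu.
  move=> F mF tF mUF; apply: cvg_toP.
    apply: ereal_nondecreasing_is_cvgn => m n mn.
    by apply: lee_sum_nneg_natr => // k _ _; exact: nu_ge0.
  by rewrite /nu ge0_integral_bigcup//; exact: measurable_funTS.
pose nuM := isMeasure.Build _ _ _ nu nu0 nu_ge0 nuS.
pose nu' : {measure set T -> \bar R} := HB.pack nu nuM.
by exists nu'.
Qed.

Lemma exists_pushforward_measure d d' (T : measurableType d)
    (T' : measurableType d') (R : realType) (m : {measure set T -> \bar R})
    (f : T -> T') : measurable_fun setT f ->
  exists m' : {measure set T' -> \bar R}, m' = pushforward m f :> (set T' -> \bar R).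
Proof.
by move=> mf; unshelve refine (ex_intro _ [the measure _ _ of pushforward m f] _).
Qed.

End measure_existence.

Section density_integral.
Context d (T : measurableType d) (R : realType) (P : probability T R).
Local Open Scope ereal_scope.
Import HBNNSimple.

(** For an indicator this is the definition of a density; simple functions follow by linearity and
    measurable [F] by monotone convergence. *)
Lemma is_density_integral d' (T' : measurableType d')
    (mu : {measure set T' -> \bar R}) (X : T -> T') (f : T' -> R) (F : T' -> \bar R) :
  is_density P mu X (EFin \o f) -> measurable_fun setT F -> (forall y, 0 <= F y) ->
  \int[P]_w F (X w) = \int[mu]_y (F y * (f y)%:E).
Proof.
move=> [mX mf f0 fE] mF F0; rewrite /= in f0.
have indicE (B : set T') : measurable B ->
    \int[P]_w (\1_B (X w))%:E = \int[mu]_y ((\1_B y)%:E * (f y)%:E).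
  move=> mB; transitivity (P (X @^-1` B)).
    rewrite -[in RHS](setIT (X @^-1` B)) -integral_indic//.
    by rewrite -[X in measurable X]setTI; exact: mX.
  rewrite fE// integral_mkcond; apply: eq_integral => y _.
  by rewrite epatch_indic muleC.
pose F_ := nnsfun_approx measurableT mF.
have F_E (n : nat) : \int[P]_w (F_ n (X w))%:E = \int[mu]_y ((F_ n y)%:E * (f y)%:E).
  under [LHS]eq_integral do rewrite fimfunE -fsumEFin//.
  under [RHS]eq_integral.
    move=> y _; rewrite fimfunE -fsumEFin// ge0_mule_fsuml; last first.
      by move=> r; rewrite EFinM nnfun_muleindic_ge0.
    over.
  have mi (r : R) : measurable_fun setT (fun y => (\1_(F_ n @^-1` [set r]) y)%:E : \bar R).
    by apply/measurable_EFinP/measurable_indic.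
  rewrite ge0_integral_fsum//; last 2 first.
  - move=> r; apply: (@measurableT_comp _ _ _ _ _ _
      (fun y => (r * \1_(F_ n @^-1` [set r]) y)%:E)) => //.
    by apply/measurable_EFinP; apply: measurable_funM.
  - by move=> r w _; rewrite EFinM nnfun_muleindic_ge0.
  rewrite ge0_integral_fsum//; last 2 first.
  - move=> r; apply: emeasurable_funM => //.
    by apply/measurable_EFinP; apply: measurable_funM.
  - by move=> r y _; rewrite mule_ge0// EFinM nnfun_muleindic_ge0.
  (* A nonnegative simple function has no negative value, so for [r < 0] the preimage is empty and
     both sides vanish. *)
  apply: eq_fsbigr => r _; have [r0|r0] := leP 0%R r; last first.
    rewrite preimage_nnfun0// !integral0_eq// => y _; rewrite indic0/=.
      by rewrite mulr0 mul0e.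
    by rewrite mulr0.
  under eq_integral do rewrite EFinM.
  rewrite ge0_integralZl//; last exact: (measurableT_comp (mi r) mX).
  rewrite indicE// -ge0_integralZl//; last 2 first.
  - exact: emeasurable_funM.
  - by move=> y _; rewrite mule_ge0// lee_fin.
  by apply: eq_integral => y _; rewrite EFinM muleA.
have cF y : (F_ n y)%:E @[n --> \oo] --> F y by exact: cvg_nnsfun_approx.
have ndF y : {homo (fun n => (F_ n y)%:E) : n m / (n <= m)%N >-> n <= m}.
  by move=> n m nm; rewrite lee_fin; exact/lefP/nd_nnsfun_approx.
have mFn n : measurable_fun setT (fun y => (F_ n y)%:E).
  exact/measurable_EFinP/measurable_funP.
transitivity (limn (fun n => \int[P]_w (F_ n (X w))%:E)).
  rewrite -monotone_convergence//.
  - by apply: eq_integral => w _; apply/esym/cvg_lim => //; exact: cF.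
  - by move=> n; exact: (measurableT_comp (mFn n) mX).
  - by move=> n w _; rewrite lee_fin.
transitivity (limn (fun n => \int[mu]_y ((F_ n y)%:E * (f y)%:E))).
  by apply: congr_lim; apply/funext.
rewrite -monotone_convergence//.
- by apply: eq_integral => y _; apply/cvg_lim => //; exact: cvgeZr.
- by move=> n; exact: emeasurable_funM.
- by move=> n y _; rewrite mule_ge0// lee_fin.
- by move=> y _ n m nm; rewrite lee_wpmul2r//; exact: ndF.
Qed.
End density_integral.

Section independence.
Context d (T : measurableType d) (R : realType) (P : probability T R).
Local Open Scope ereal_scope.

(** Independence makes the joint law agree with the product of the marginal laws on rectangles,
    hence everywhere, and Tonelli's theorem iterates the integral. *)
Lemma independent_integral d1 d2 (T1 : measurableType d1)
    (T2 : measurableType d2) (X : T -> T1) (Y : T -> T2)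
    (F : T1 * T2 -> \bar R) :
  measurable_fun setT X -> measurable_fun setT Y ->
  (forall A B, measurable A -> measurable B ->
    P (X @^-1` A `&` Y @^-1` B) = P (X @^-1` A) * P (Y @^-1` B)) ->
  measurable_fun setT F -> (forall z, 0 <= F z) ->
  \int[P]_w F (X w, Y w) = \int[P]_w \int[P]_v F (X w, Y v).
Proof.
move=> mX mY XY mF F0.
pose X' : {mfun T >-> T1} := HB.pack X (isMeasurableFun.Build _ _ _ _ _ mX).
pose Y' : {mfun T >-> T2} := HB.pack Y (isMeasurableFun.Build _ _ _ _ _ mY).
have mZ : measurable_fun setT (fun w => (X w, Y w)) by exact: measurable_fun_pair.
pose Z' : {mfun T >-> (T1 * T2)%type} :=
  HB.pack (fun w => (X w, Y w)) (isMeasurableFun.Build _ _ _ _ _ mZ).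
transitivity (\int[distribution P Z']_z F z).
  by rewrite ge0_integral_distribution.
rewrite (eq_measure_integral (distribution P X' \x distribution P Y')); last first.
  move=> A mA _; apply/esym/product_measure_unique => // B C mB mC; exact: XY.
rewrite fubini_tonelli1// ge0_integral_distribution//=; last 2 first.
- exact: measurable_fun_fubini_tonelli_F.
- by move=> x; exact: integral_ge0.
apply: eq_integral => w _; rewrite /fubini_F/=.
by rewrite ge0_integral_distribution//; exact: measurableT_comp.
Qed.

(** As [B] is not restricted to rectangles, a uniqueness argument is used: for fixed [A] both sides
    are finite measures in [B], and they agree on rectangles, a generating pi-system. *)
Lemma independent3_pair d1 d2 d3 (T1 : measurableType d1)
    (T2 : measurableType d2) (T3 : measurableType d3)
    (X : T -> T1) (Y : T -> T2) (Z : T -> T3) :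
  measurable_fun setT X -> measurable_fun setT Y -> measurable_fun setT Z ->
  independent3 P X Y Z ->
  forall A B, measurable A -> measurable B ->
    P (Y @^-1` A `&` (fun w => (Z w, X w)) @^-1` B) =
    P (Y @^-1` A) * P ((fun w => (Z w, X w)) @^-1` B).
Proof.
move=> mX mY mZ XYZ A B mA mB.
have mZX : measurable_fun setT (fun w => (Z w, X w)) by exact: measurable_fun_pair.
have mYA : measurable (Y @^-1` A) by rewrite -[X in measurable X]setTI; exact: mY.
pose W : {mfun T >-> (T3 * T1)%type} :=
  HB.pack (fun w => (Z w, X w)) (isMeasurableFun.Build _ _ _ _ _ mZX).
have [m1 m1PE] := exists_pushforward_measure (mrestr P mYA) mZX.
have m1E C : m1 C = P (Y @^-1` A `&` W @^-1` C).
  by rewrite m1PE /pushforward /mrestr setIC.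
pose p : {nonneg R} := NngNum (fine_ge0 (measure_ge0 P (Y @^-1` A))).
pose m2 : {measure set (T3 * T1) -> \bar R} :=
  [the measure _ _ of mscale p (distribution P W)].
have pE : p%:num%:E = P (Y @^-1` A) by rewrite /= fineK// fin_num_measure.
have m2E C : m2 C = P (Y @^-1` A) * P (W @^-1` C).
  by rewrite /m2 /= /mscale -pE.
rewrite -m1E -m2E.
pose G : set (set (T3 * T1)) :=
  [set C | exists2 A, measurable A & exists2 B, measurable B & A `*` B = C].
apply: (measure_unique G (fun=> setT)) => //.
- rewrite measurable_prod_measurableType.
  by congr (<<s _ >>); apply/seteqP; split.
- move=> _ _ [C1 mC1 [D1 mD1 <-]] [C2 mC2 [D2 mD2 <-]].
  exists (C1 `&` C2); first exact: measurableI.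
  by exists (D1 `&` D2); [exact: measurableI|rewrite setXI].
- by move=> _; exists setT => //; exists setT => //; rewrite setXTT.
- by rewrite bigcup_const.
- move=> _ [C mC [D mD <-]]; rewrite m1E m2E.
  have -> : W @^-1` (C `*` D) = X @^-1` D `&` Z @^-1` C.
    by apply/seteqP; split=> w [].
  (* Taking the whole space for [Y] gives the independence of [X] and [Z], which splits the law of
     the pair on a rectangle. *)
  have := XYZ D setT C mD measurableT mC.
  rewrite !preimage_setT setIT probability_setT mule1 => ->.
  rewrite setIA (setIC (Y @^-1` A)) XYZ//.
  by rewrite (muleC (P (X @^-1` D))) -muleA.
- by move=> _; rewrite m1E preimage_setT setIT ltey_eq fin_num_measure.
Qed.

(** Independence iterates the expectation, each layer becomes an integral against its own density,
    and Tonelli's theorem reassembles them. *)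
Lemma independent_density d1 d2 (T1 : measurableType d1)
    (T2 : measurableType d2) (m1 : {sigma_finite_measure set T1 -> \bar R})
    (m2 : {sigma_finite_measure set T2 -> \bar R})
    (X : T -> T1) (Y : T -> T2) (f : T1 -> R) (g : T2 -> R)
    (F : T1 * T2 -> \bar R) :
  is_density P m1 X (EFin \o f) -> is_density P m2 Y (EFin \o g) ->
  (forall A B, measurable A -> measurable B ->
    P (X @^-1` A `&` Y @^-1` B) = P (X @^-1` A) * P (Y @^-1` B)) ->
  measurable_fun setT F -> (forall z, 0 <= F z) ->
  \int[P]_w F (X w, Y w) =
  \int[m1 \x m2]_z (F z * (f z.1)%:E * (g z.2)%:E).
Proof.
move=> dX dY XY mF F0.
have [mX mf f0 _] := dX; have [mY mg g0 _] := dY; rewrite /= in f0 g0.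
have mFg : measurable_fun setT (fun z : T1 * T2 => F z * (g z.2)%:E).
  by apply: emeasurable_funM => //; exact: (measurableT_comp mg measurable_snd).
have Fg0 z : 0 <= F z * (g z.2)%:E by exact: mule_ge0.
rewrite (independent_integral mX mY XY mF F0).
transitivity (\int[P]_w \int[m2]_y (F (X w, y) * (g y)%:E)).
  apply: eq_integral => w _.
  apply: (is_density_integral (F := fun y => F (X w, y)) dY) => //.
  exact: measurableT_comp.
rewrite (is_density_integral
  (F := fun x => \int[m2]_y (F (x, y) * (g y)%:E)) dX); last 2 first.
- exact: (measurable_fun_fubini_tonelli_F _ mFg).
- by move=> x; apply: integral_ge0 => y _; exact: (Fg0 (x, y)).
rewrite fubini_tonelli1; last 2 first.
- apply: emeasurable_funM; last exact: (measurableT_comp mg measurable_snd).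
  by apply: emeasurable_funM => //; exact: (measurableT_comp mf measurable_fst).
- by move=> z; rewrite muleAC mule_ge0.
apply: eq_integral => x _; rewrite /fubini_F /=.
rewrite -ge0_integralZr//; last exact: (measurableT_comp mFg (pair1_measurable x)).
by apply: eq_integral => y _; rewrite muleAC.
Qed.
End independence.

(** * Affine images of random variables *)

Section affine.
Context (R : realType).
Local Open Scope ereal_scope.
Local Notation mu := (@lebesgue_measure R).

(** The image of Lebesgue measure under v = a h + s, multiplied by [h], gives every half-open
    interval its length, so it is Lebesgue measure. *)
Lemma ge0_integral_affine (h s : R) (F : measurableTypeR R -> \bar R) : (0 < h)%R ->
  measurable_fun setT F -> (forall v, 0 <= F v) ->
  \int[mu]_v F v = \int[mu]_a (F (a * h + s)%R * h%:E).
Proof.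
move=> h0 mF F0.
pose phi (a : measurableTypeR R) : measurableTypeR R := (a * h + s)%R.
have mphi : measurable_fun setT phi.
  by apply: measurable_funD => //; apply: measurable_funM.
pose p : {nonneg R} := NngNum (ltW h0).
have [m0 m0PE] := exists_pushforward_measure mu mphi.
have m0E : m0 = pushforward mu phi :> (set _ -> _) by exact: m0PE.
pose m1 : {measure set (measurableTypeR R) -> \bar R} := [the measure _ _ of mscale p m0].
have muE : forall A, measurable A -> mu A = m1 A.
  apply: lebesgue_measure_unique => _ [[a b] /= _ <-].
  rewrite /m1/= /mscale m0E /pushforward.
  have -> : phi @^-1` `]a, b] = `]((a - s) / h)%R, ((b - s) / h)%R]%classic.
    apply/seteqP; split=> v; rewrite /= !in_itv/= /phi.
      by rewrite ltr_pdivrMr// ltrBlDr ler_pdivlMr// lerBrDr.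
    by rewrite ltr_pdivrMr// ltrBlDr ler_pdivlMr// lerBrDr.
  rewrite !lebesgue_measure_itv/= !lte_fin ltr_pM2r ?invr_gt0// ltrD2r.
  case: ifPn => ab; last by rewrite mule0.
  rewrite -!EFinB -EFinM; congr EFin; field.
  by rewrite gt_eqF.
rewrite (eq_measure_integral m1); last by move=> A mA _; exact: muE.
rewrite ge0_integral_mscale// m0E ge0_integral_pushforward// preimage_setT.
under [RHS]eq_integral do rewrite muleC.
by rewrite ge0_integralZl//; [exact: measurableT_comp|rewrite lee_fin ltW].
Qed.
End affine.

Section affine_density.
Context d (T : measurableType d) (R : realType) (P : probability T R).
Context d2 (T2 : measurableType d2).
Variables (Y : T -> measurableTypeR R) (Z : T -> T2) (f : R -> R) (k s : T2 -> R).
Local Open Scope ereal_scope.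
Local Notation mu := (@lebesgue_measure R).
Hypotheses (dY : is_density P mu Y (EFin \o f)) (mZ : measurable_fun setT Z)
  (mk : measurable_fun setT k) (ms : measurable_fun setT s)
  (k0 : forall z, (0 < k z)%R)
  (YZ : forall A B, measurable A -> measurable B ->
    P (Y @^-1` A `&` Z @^-1` B) = P (Y @^-1` A) * P (Z @^-1` B)).

(** The density at [p.1] of [Y / k z + s z] with [z] frozen at [Z p.2]; the outer factor [k] is the
    Jacobian. *)
Let G (p : measurableTypeR R * T) := (f (k (Z p.2) * (p.1 - s (Z p.2))) * k (Z p.2))%:E.

Let mf : measurable_fun setT f.
Proof. by have [_ /measurable_EFinP] := dY. Qed.

Let f0 y : (0 <= f y)%R.
Proof. by have [_ _ /(_ y)] := dY; rewrite lee_fin. Qed.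

Let mG : measurable_fun setT G.
Proof.
have mkZ : measurable_fun setT (fun p : measurableTypeR R * T => k (Z p.2)).
  exact: (measurableT_comp mk (measurableT_comp mZ measurable_snd)).
have msZ : measurable_fun setT (fun p : measurableTypeR R * T => s (Z p.2)).
  exact: (measurableT_comp ms (measurableT_comp mZ measurable_snd)).
apply/measurable_EFinP; apply: measurable_funM => //.
apply: (measurableT_comp mf); apply: measurable_funM => //.
apply: measurable_funB => //.
Qed.

Let G0 p : 0 <= G p.
Proof. by rewrite lee_fin mulr_ge0// ltW. Qed.

Lemma measurable_affine_density :
  measurable_fun setT (fun u : measurableTypeR R =>
    \int[P]_w (f (k (Z w) * (u - s (Z w))) * k (Z w))%:E).
Proof. exact: (measurable_fun_fubini_tonelli_F (m2 := P) G mG G0). Qed.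

(** Independence allows [Z] to be frozen: the affine variable then has the density [G], and this is
    averaged over [Z]. *)
Lemma is_density_affine :
  is_density P mu (fun w => Y w / k (Z w) + s (Z w))%R
    (fun u => \int[P]_w (f (k (Z w) * (u - s (Z w))) * k (Z w))%:E).
Proof.
have [mY _ _ fE] := dY.
have mkV : measurable_fun setT (fun z => (k z)^-1)%R.
  (* Positivity of [k] lets the inverse be written with [expR] and [ln], which are measurable. *)
  have -> : (fun z => (k z)^-1)%R = (fun z => expR (- ln (k z)))%R.
    by apply/funext => z; rewrite expRN lnK// posrE.
  apply: measurableT_comp => //.
  by apply: measurable_funN; exact: measurableT_comp.
have mkZ := measurableT_comp mkV mZ.
have msZ := measurableT_comp ms mZ.
have mV : measurable_fun setT (fun w => Y w / k (Z w) + s (Z w))%R.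
  by apply: measurable_funD => //; apply: measurable_funM.
split => //.
- exact: measurable_affine_density.
- by move=> u; apply: integral_ge0 => w _; exact: (G0 (u, w)).
move=> B mB.
pose F (p : T2 * measurableTypeR R) : \bar R := (\1_B (p.2 / k p.1 + s p.1)%R)%:E.
have mF : measurable_fun setT F.
  apply/measurable_EFinP; have mi := measurable_indic (R := R) (D := setT) mB.
  apply: (measurableT_comp mi).
  apply: measurable_funD; last exact: (measurableT_comp ms measurable_fst).
  by apply: measurable_funM => //; exact: (measurableT_comp mkV measurable_fst).
have F0 p : 0 <= F p by rewrite lee_fin.
transitivity (\int[P]_w F (Z w, Y w)).
  rewrite -[X in P X](setIT) -integral_indic//.
  by rewrite -[X in measurable X]setTI; exact: mV.
rewrite (independent_integral (X := Z) (Y := Y))//; last first.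
  by move=> C D mC mD; rewrite setIC muleC; exact: YZ.
transitivity (\int[P]_w \int[mu]_v ((\1_B v)%:E * G (v, w))).
  apply: eq_integral => w _.
  rewrite (is_density_integral (F := fun y => F (Z w, y)) dY)//; last exact: measurableT_comp.
  (* The substitution v = a / k + s contributes 1 / k, which cancels the factor [k] in [G]. *)
  rewrite (@ge0_integral_affine _ (k (Z w))^-1%R (s (Z w)))//; last 3 first.
  - by rewrite invr_gt0.
  - apply: emeasurable_funM; last exact: (measurableT_comp mG (pair2_measurable w)).
    exact/measurable_EFinP/measurable_indic.
  - by move=> v; rewrite mule_ge0// lee_fin.
  apply: eq_integral => a _; rewrite /F /G /=.
  have kne0 : k (Z w) != 0%R by rewrite gt_eqF.
  rewrite addrK mulrCA divff// mulr1 -!EFinM; congr EFin.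
  by rewrite -!mulrA divff// mulr1.
rewrite (fubini_tonelli (fun p => (\1_B p.2)%:E * G (p.2, p.1))) /=; last 2 first.
- apply: emeasurable_funM; last first.
    exact: (measurableT_comp mG (measurable_fun_pair measurable_snd measurable_fst)).
  apply/measurable_EFinP.
  exact: (measurableT_comp (measurable_indic (R := R) (D := setT) mB) measurable_snd).
- by move=> p; rewrite mule_ge0// lee_fin.
rewrite [RHS]integral_mkcond; apply: eq_integral => v _.
rewrite epatch_indic ge0_integralZl//; last exact: (measurableT_comp mG (pair1_measurable v)).
by rewrite muleC.
Qed.
End affine_density.

(** * Limits of densities *)

Section limits.
Context (R : realType).
Local Open Scope ereal_scope.

Lemma limn_einf_le (u : (\bar R)^nat) (x : \bar R) n :
  (forall m, (n <= m)%N -> u m <= x) -> limn_einf u <= x.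
Proof.
move=> ux; rewrite limn_einf_lim; apply: lime_le; first exact: is_cvg_einfs.
apply: nearW => k; apply: (@le_trans _ _ (u (maxn k n))).
  by apply: ereal_inf_lbound; exists (maxn k n) => //=; exact: leq_maxl.
by apply: ux; exact: leq_maxr.
Qed.

Lemma limn_einf_ge (u : (\bar R)^nat) (x : \bar R) n :
  (forall m, (n <= m)%N -> x <= u m) -> x <= limn_einf u.
Proof.
move=> ux; rewrite limn_einf_lim; apply: lime_ge; first exact: is_cvg_einfs.
exists n => // k /= nk; apply: le_ereal_inf_tmp => _ [m /= km <-].
by apply: ux; exact: leq_trans nk km.
Qed.

Lemma limn_einf_le_cvg (u v : (\bar R)^nat) (x : \bar R) :
  (forall n, u n <= v n) -> v n @[n --> \oo] --> x -> limn_einf u <= x.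
Proof.
move=> uv vx; rewrite limn_einf_lim -(cvg_lim _ vx)//.
apply: lee_lim; [exact: is_cvg_einfs|by apply/cvg_ex; exists x|].
apply: nearW => n; apply: le_trans (uv n).
by apply: ereal_inf_lbound; exists n => /=.
Qed.

Lemma measurable_fun_limn_einf d (T : measurableType d) (D : set T)
    (f : (T -> \bar R)^nat) : (forall n, measurable_fun D (f n)) ->
  measurable_fun D (fun x => limn_einf (f ^~ x)).
Proof.
move=> mf; apply: measurableT_comp => //.
by apply: measurable_fun_limn_esup => n; apply: measurableT_comp.
Qed.

Variables (f c : (\bar R)^nat).
Hypotheses (c0 : forall n, 0 <= c n) (coo : \sum_(0 <= k <oo) c k < +oo).
Hypotheses (fc : forall n, f n.+1 <= f n + c n) (cf : forall n, f n <= f n.+1 + c n).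
Local Notation r n := (\sum_(n <= k <oo) c k).

Lemma tail_fin_num n : r n \is a fin_num.
Proof.
rewrite ge0_fin_numE; last exact: nneseries_ge0.
apply: le_lt_trans coo; rewrite [leRHS](nneseries_split 0 n)//.
by rewrite leeDr// sume_ge0.
Qed.

Let rS n : r n = c n + r n.+1.
Proof. by rewrite (nneseries_split n 1)// addn1 big_nat1. Qed.

(** The increments telescope to [f m <= f n + r n] for all m >= n. Additive bounds stay meaningful
    where [f n] is [+oo]. *)
Lemma near_limn_einf_le n : limn_einf f <= f n + r n.
Proof.
apply: (@limn_einf_le _ _ n) => m nm; rewrite -(subnKC nm).
(* Induction on the gap m - n with [n] generalised: the tail loses its first term as the base index
   moves up by one. *)
move: (m - n)%N => j {nm m}; elim: j n => [|j ih] n.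
  by rewrite addn0 leeDl// nneseries_ge0.
rewrite addnS -addSn; apply: (le_trans (ih _)).
by rewrite [in leRHS]rS addeA leeD2r.
Qed.

Lemma near_limn_einf_ge n : f n <= limn_einf f + r n.
Proof.
rewrite -leeBlDr ?tail_fin_num//.
apply: (@limn_einf_ge _ _ n) => m nm; rewrite leeBlDr ?tail_fin_num// -(subnKC nm).
move: (m - n)%N => j {nm m}; elim: j n => [|j ih] n.
  by rewrite addn0 leeDl// nneseries_ge0.
rewrite addnS -addSn [in leRHS]rS (addeC (c n)) addeA (le_trans (cf n))//.
by rewrite leeD2r.
Qed.
End limits.

Section portmanteau.
Context d (T : measurableType d) (R : realType) (P : probability T R).
Local Open Scope ereal_scope.

(** If V(w) lies in the open set [O], then U_n(w) is eventually in [O]. So the indicator at the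
    limit is almost surely at most the lower limit of the indicators, and Fatou's lemma
    concludes. *)
Lemma open_portmanteau (U : nat -> T -> measurableTypeR R)
    (V : T -> measurableTypeR R) (O : set R) :
  (forall n, measurable_fun setT (U n)) -> measurable_fun setT V ->
  {ae P, forall w, (U n w : R) @[n --> \oo] --> (V w : R)} -> open O ->
  P (V @^-1` O) <= limn_einf (fun n => P (U n @^-1` O)).
Proof.
move=> mU mV UV oO.
have mO : measurable (O : set (measurableTypeR R)) by exact: open_measurable.
have mi := measurable_indic (R := R) (D := setT) mO.
have PE (X : T -> measurableTypeR R) : measurable_fun setT X ->
    P (X @^-1` O) = \int[P]_w (\1_O (X w))%:E.
  move=> mX; rewrite -[X in P X](setIT) -integral_indic//.
  by rewrite -[X in measurable X]setTI; exact: mX.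
rewrite PE//.
under [X in _ <= limn_einf X]eq_fun do rewrite PE//.
apply: (@le_trans _ _ (\int[P]_w limn_einf (fun n => (\1_O (U n w))%:E))); last first.
  by apply: fatou => // n; apply/measurable_EFinP; exact: (measurableT_comp mi (mU n)).
apply: ae_ge0_le_integral => //.
- by apply/measurable_EFinP; exact: (measurableT_comp mi mV).
- by move=> w _; apply: (@limn_einf_ge _ _ _ 0) => m _; rewrite lee_fin.
- apply: measurable_fun_limn_einf => n.
  by apply/measurable_EFinP; exact: (measurableT_comp mi (mU n)).
apply: filterS UV => w UVw _; rewrite indicE.
have [/set_mem Vw|Vw] := boolP (V w \in O); last first.
  by apply: (@limn_einf_ge _ _ _ 0) => m _; rewrite lee_fin.
have [n _ nU] := UVw _ (open_nbhs_nbhs (conj oO Vw)).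
apply: (@limn_einf_ge _ _ _ n) => m nm.
by rewrite indicE mem_set//; exact: nU.
Qed.
End portmanteau.

Section interval_density.
Local Open Scope ereal_scope.

Context d (T : measurableType d) (R : realType) (P : probability T R).
Local Notation mu := (@lebesgue_measure R).

(** The two bounds differ only at the endpoints. Once the law of [V] is seen to have no atoms, they
    determine it on half-open intervals, which generate the Borel sets. *)
Lemma is_density_interval (V : T -> measurableTypeR R) (g : measurableTypeR R -> \bar R) :
  measurable_fun setT V -> measurable_fun setT g -> (forall y, 0 <= g y) ->
  (forall a b : R, P (V @^-1` `]a, b[%classic) <= \int[mu]_(y in `]a, b[) g y) ->
  (forall a b : R, \int[mu]_(y in `[a, b]) g y <= P (V @^-1` `[a, b]%classic)) ->
  is_density P mu V g.
Proof.
move=> mV mg g0 Voo Vcc; split => // B mB.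
have [nu nuE] := exists_density_measure mu mg g0.
have [muV muVE] := exists_pushforward_measure P mV.
rewrite -nuE (_ : P _ = muV B); last by rewrite muVE.
have oo (a b : R) : muV `]a, b[%classic <= nu `]a, b[%classic.
  by rewrite muVE nuE; exact: Voo.
have cc (a b : R) : nu `[a, b]%classic <= muV `[a, b]%classic.
  by rewrite muVE nuE; exact: Vcc.
have muV1 A : measurable A -> muV A <= 1.
  move=> mA; rewrite muVE; apply: probability_le1.
  by rewrite -[X in measurable X]setTI; exact: mV.
have mitv (i : interval R) : measurable ([set` i] : set (measurableTypeR R)).
  by [].

(* Open intervals shrinking to [c] bound the atom, and their [nu]-masses tend to the [nu]-mass of a
   point, which is zero. *)
have atom (c : R) : muV [set c] = 0.
  pose J (n : nat) : set (measurableTypeR R) :=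
    `](c - n.+1%:R^-1)%R, (c + n.+1%:R^-1)%R[%classic.
  have cJ n : J n c.
    by rewrite /J/= in_itv/= ltrBlDr ltrDl invr_gt0 ltr0n.
  have JE : \bigcap_n J n = [set c].
    apply/seteqP; split => [y Jy|_ -> n _//].
    apply/eqP; case: (ltgtP (y : R) c) => // /ltr_add_invr[k].
    - have := Jy k I; rewrite /J/= in_itv/= => /andP[+ _].
      by rewrite ltrBlDr => /ltW; rewrite leNgt => /negbTE ->.
    - have := Jy k I; rewrite /J/= in_itv/= => /andP[_].
      by move=> /ltW; rewrite leNgt => /negbTE ->.
  have nuI : (nu \o J) n @[n --> \oo] --> nu [set c].
    rewrite -JE; apply: nonincreasing_cvg_mu.
    (* Continuity from above starts from a set of finite mass: [J 0] lies in a compact interval,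
       where [nu] is at most the law of [V]. *)
    - apply: (@le_lt_trans _ _ (nu `[(c - 1)%R, (c + 1)%R]%classic)).
        apply: le_measure; rewrite ?inE//; first exact: mitv.
        by rewrite /J invr1; apply: subset_itv; rewrite bnd_simp.
      by apply: (le_lt_trans (cc _ _)); apply: (le_lt_trans (muV1 _ _)); rewrite ?ltry.
    - by move=> n; exact: mitv.
    - by apply: bigcap_measurable => // n _; exact: mitv.
    - move=> n k nk; apply/subsetPset; apply: subset_itv; rewrite bnd_simp.
        by rewrite lerD2l lerN2 lef_pV2 ?posrE// ler_nat.
      by rewrite lerD2l lef_pV2 ?posrE// ler_nat.
  have nuc : nu [set c] = 0 by rewrite nuE integral_set1.
  rewrite nuc in nuI.
  apply/eqP; rewrite eq_le measure_ge0 andbT.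
  rewrite -(cvg_lim _ nuI)//; apply: lime_ge; first by apply/cvg_ex; exists 0.
  apply: nearW => n /=; apply: le_trans (oo _ _); apply: le_measure; rewrite ?inE//.
  by move=> _ ->; exact: cJ.
apply: (@measure_unique _ R (measurableTypeR R) (@ocitv R)
  (fun k => `](- k%:R)%R, k%:R]%classic)) => //.
- exact: ocitvI.
- by move=> k; exact: is_ocitv.
- exact: (@bigcup_itvT R false false).
- move=> _ [[a b] /= ab <-]; have [ltab|ba] := ltP a b; last first.
    by rewrite set_itv_ge ?measure0// bnd_simp -leNgt.
  (* The upper bound discards the endpoint [b] and the lower one adds the endpoint [a]; both are
     null for the law of [V]. *)
  apply/eqP; rewrite eq_le; apply/andP; split.
    rewrite -(@setUitv1 _ _ (BRight a) b true) ?bnd_simp// measureU0//.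
    apply: (le_trans (oo _ _)); apply: le_measure; rewrite ?inE//.
    exact: measurableU.
  have <- : muV (`]a, b]%classic `|` [set a]) = muV `]a, b]%classic.
    by rewrite measureU0.
  rewrite setUC setU1itv ?bnd_simp ?(ltW ltab)//. apply: (le_trans _ (cc a b)).
  apply: le_measure; rewrite ?inE//.
  by apply: subset_itv; rewrite bnd_simp.
- by move=> k; apply: (le_lt_trans (muV1 _ _)); rewrite ?ltry.
Qed.
End interval_density.

Section density_limit.
Local Open Scope ereal_scope.
Context d (T : measurableType d) (R : realType) (P : probability T R).
Local Notation mu := (@lebesgue_measure R).

Variables (U : nat -> T -> measurableTypeR R) (V : T -> measurableTypeR R).
Variables (f : nat -> measurableTypeR R -> \bar R) (c : nat -> \bar R).
Hypotheses (dU : forall n, is_density P mu (U n) (f n))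
  (mV : measurable_fun setT V)
  (UV : {ae P, forall w, (U n w : R) @[n --> \oo] --> (V w : R)})
  (c0 : forall n, 0 <= c n) (coo : \sum_(0 <= k <oo) c k < +oo)
  (fc : forall n y, f n.+1 y <= f n y + c n)
  (cf : forall n y, f n y <= f n.+1 y + c n).

Let mU n : measurable_fun setT (U n). Proof. by have [] := dU n. Qed.
Let mf n : measurable_fun setT (f n). Proof. by have [] := dU n. Qed.
Let f0 n y : 0 <= f n y. Proof. by have [] := dU n. Qed.
Let fE n B : measurable B -> P (U n @^-1` B) = \int[mu]_(y in B) f n y.
Proof. by have [_ _ _] := dU n; exact. Qed.

(** A lower limit exists and is measurable before any convergence is known, even where the [f n] are
    infinite. *)
Let g y := limn_einf (f ^~ y).
Let r n := \sum_(n <= k <oo) c k.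

Let mg : measurable_fun setT g.
Proof. exact: measurable_fun_limn_einf. Qed.

Let g0 y : 0 <= g y.
Proof. by apply: (@limn_einf_ge _ _ _ 0). Qed.

Let r0 n : 0 <= r n. Proof. exact: nneseries_ge0. Qed.

Let rfin n : r n \is a fin_num. Proof. exact: tail_fin_num. Qed.

Let rcvg0 : r n @[n --> \oo] --> 0.
Proof. exact: (nneseries_tail_cvg coo). Qed.

Let gf n y : g y <= f n y + r n.
Proof. exact: (near_limn_einf_le c0 (fun n => fc n y)). Qed.

Let fg n y : f n y <= g y + r n.
Proof. exact: (near_limn_einf_ge c0 coo (fun n => cf n y)). Qed.

Let integral_shift (h h' : measurableTypeR R -> \bar R) n (A : set (measurableTypeR R)) :
  measurable A -> measurable_fun setT h -> measurable_fun setT h' ->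
  (forall y, 0 <= h y) -> (forall y, 0 <= h' y) -> (forall y, h y <= h' y + r n) ->
  \int[mu]_(y in A) h y <= \int[mu]_(y in A) h' y + r n * mu A.
Proof.
move=> mA mh mh' h0 h'0 hh'.
rewrite -integral_cst// -ge0_integralD//; [|exact: measurable_funTS|by move=> y _; exact: r0].
by apply: ge0_le_integral => //; [exact: measurable_funTS|
  apply: emeasurable_funD => //; exact: measurable_funTS].
Qed.

Let mu_itv_fin (a b : R) b0 b1 : mu [set` Interval (BSide b0 a) (BSide b1 b)] \is a fin_num.
Proof. by rewrite lebesgue_measure_itv/=; case: ifPn. Qed.

(** By [open_portmanteau] it is enough to bound the integrals of [f n]; each exceeds that of [g] by
    at most [r n] times the finite length of the interval. *)
Let Voo (a b : R) : P (V @^-1` `]a, b[%classic) <= \int[mu]_(y in `]a, b[) g y.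
Proof.
apply: (le_trans (open_portmanteau mU mV UV (itv_open_ends_open _))) => //.
apply: (@limn_einf_le_cvg _ _ (fun n => \int[mu]_(y in `]a, b[) g y + r n * mu `]a, b[%classic)).
  move=> n; rewrite fE; last exact: measurable_itv.
  by apply: integral_shift => //; exact: measurable_itv.
rewrite -[X in _ --> X]adde0 -(mul0e (mu `]a, b[%classic)).
(* The integral of [g] may still be infinite here; its sum with zero is defined in every case. *)
apply: cvgeD; first by rewrite mul0e; case: (integral _ _ _).
  exact: cvg_cst.
by apply: cvgeZr => //; exact: mu_itv_fin.
Qed.

(** The complement of the interval is open but of infinite length, so the error is estimated on the
    compact side and passed to the complement through P(U_n outside K) = 1 - P(U_n in K). *)
Let Vcc (a b : R) : \int[mu]_(y in `[a, b]) g y <= P (V @^-1` `[a, b]%classic).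
Proof.
set K : set (measurableTypeR R) := `[a, b]%classic.
have mK : measurable K by exact: measurable_itv.
have mXK (X : T -> measurableTypeR R) : measurable_fun setT X -> measurable (X @^-1` K).
  by move=> mX; rewrite -[X in measurable X]setTI; exact: mX.
have PC (X : T -> measurableTypeR R) : measurable_fun setT X ->
    P (X @^-1` ~` K) = 1 - P (X @^-1` K).
  by move=> mX; rewrite preimage_setC probability_setC//; exact: mXK.
have Pfin (X : T -> measurableTypeR R) : measurable_fun setT X ->
    P (X @^-1` K) \is a fin_num.
  by move=> mX; rewrite fin_num_measure//; exact: mXK.
set x := integral _ _ _.
have xle n : x <= P (U n @^-1` K) + r n * mu K.
  by rewrite fE//; exact: integral_shift.
have xfin : x \is a fin_num.
  rewrite ge0_fin_numE; last exact: integral_ge0.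
  apply: (le_lt_trans (xle 0%N)); rewrite ltey_eq fin_numD Pfin//= fin_numM//.
  exact: mu_itv_fin.
clearbody x; have : P (V @^-1` ~` K) <= 1 - x.
  have oK : open (~` K : set R) by apply: closed_openC; exact: itv_closed.
  apply: (le_trans (open_portmanteau mU mV UV oK)).
  apply: (@limn_einf_le_cvg _ _ (fun n => 1 - x + r n * mu K)).
    move=> n; rewrite PC//; move: {xle}(xle n) (Pfin _ (mU n)) xfin.
    have : r n * mu K \is a fin_num by rewrite fin_numM//; exact: mu_itv_fin.
    move: (r n * mu K) (P _) x => [e| |]// [p| |]// [x| |]// _ + _ _.
    by rewrite !lee_fin; lra.
  rewrite -[X in _ --> X]adde0 -(mul0e (mu K)).
  apply: cvgeD; first by rewrite mul0e; case: (1 - x).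
    exact: cvg_cst.
  by apply: cvgeZr => //; exact: mu_itv_fin.
rewrite PC//; move: {xle}(Pfin _ mV) xfin.
by move: (P _) x => [p| |]// [x| |]// _ _; rewrite !lee_fin; lra.
Qed.

(** [f 0] has total mass one, hence is finite almost everywhere, and [g] exceeds it by at most
    [r 0]. *)
Let ae_g_fin : {ae mu, forall y, g y \is a fin_num}.
Proof.
have if0 : mu.-integrable setT (f 0).
  apply/integrableP; split => //.
  under eq_integral do rewrite gee0_abs//.
  by rewrite -fE// preimage_setT probability_setT ltry.
have := integrable_ae measurableT if0; apply: filterS => y /(_ I) f0y.
by rewrite ge0_fin_numE// (le_lt_trans (gf 0 y))// ltey_eq fin_numD f0y rfin.
Qed.

Lemma density_limit : exists h : R -> R,
  is_density P mu V (EFin \o h) /\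
  'N[mu]_+oo[(fun y => f n y - (h y)%:E)] @[n --> \oo] --> 0.
Proof.
(* [fine] sends infinite values to zero, which alters [g] only on a null set. *)
exists (fine \o g); split.
  have [_ _ _ gE] := is_density_interval mV mg g0 Voo Vcc.
  split => //.
  - by apply/measurable_EFinP; exact: measurableT_comp.
  - by move=> y; rewrite lee_fin fine_ge0.
  move=> B mB; rewrite gE//; apply: ae_eq_integral => //.
  - exact: measurable_funTS.
  - by apply: measurable_funTS; apply/measurable_EFinP; exact: measurableT_comp.
  by apply: filterS ae_g_fin => y gy _; rewrite /= fineK.
have le_r n : 'N[mu]_+oo[(fun y => f n y - (fine (g y))%:E)] <= r n.
  rewrite unlock /Lnorm; case: ifPn => // _.
  apply/ess_supP; apply: filterS ae_g_fin => y gy /=.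
  (* With [g y] and [r n] finite, the two bounds force [f n y] to be finite and become real
     inequalities. *)
  move: (gf n y) (fg n y) gy (rfin n).
  move: (g y) (f n y) (r n) => [a| |]// [b| |]// [e| |]// + + _ _.
  by rewrite /= !lee_fin ler_norml => ? ?; apply/andP; split; lra.
apply: (@squeeze_cvge _ _ _ _ (cst 0) _ r) => //.
- by apply: nearW => n; rewrite Lnorm_ge0 le_r.
- exact: cvg_cst.
Qed.
End density_limit.

(** * The sine coefficients *)

Section energy.
Context d (T : measurableType d) (R : realType) (P : probability T R).
Variable phi : T -> R -> R.
Local Open Scope ereal_scope.
Local Notation mu := (@lebesgue_measure R).
Local Notation I01 := (`[0%R, 1%R]%classic : set (measurableTypeR R)).
Hypothesis phiL2 : L2_process P phi.

Definition energy (w : T) := \int[mu]_(y in `[0%R, 1%R]) (`|phi w y| ^+ 2)%:E.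

Lemma energy_ge0 w : 0 <= energy w.
Proof. by apply: integral_ge0 => y _; rewrite lee_fin exprn_ge0. Qed.

(* [phi] is cut off outside [0, 1] to become measurable on the whole product. *)
Let Phi := (fun z : T * measurableTypeR R => phi z.1 z.2) \_ (setT `*` I01).

Let mPhi : measurable_fun setT Phi.
Proof.
apply/(measurable_restrictT _ _).1; last exact: phiL2.1.
by apply: measurableX => //; exact: measurable_itv.
Qed.

Let PhiE w y : y \in `[0%R, 1%R] -> Phi (w, y) = phi w y.
Proof. by move=> y01; rewrite /Phi patchE/= mem_set. Qed.

Lemma measurable_phi_section w : measurable_fun I01 (phi w : measurableTypeR R -> R).
Proof.
apply: (eq_measurable_fun (fun y : measurableTypeR R => Phi (w, y))).
  by move=> y /[!inE] y01; rewrite PhiE.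
by apply: measurable_funTS; exact: (measurableT_comp mPhi (pair1_measurable w)).
Qed.

(** Tonelli's theorem applies to the cut-off process, whose square integrates over the whole line to
    the energy. *)
Lemma measurable_energy : measurable_fun setT energy.
Proof.
pose F z := (`|Phi z| ^+ 2)%:E.
have -> : energy = fubini_F mu F.
  apply/funext => w; rewrite /energy /fubini_F [LHS]integral_mkcond.
  apply: eq_integral => y _; rewrite patchE /F /Phi patchE/= in_setX/= in_setT/=.
  by case: ifPn => // _; rewrite normr0 expr0n.
apply: measurable_fun_fubini_tonelli_F => //.
  by apply/measurable_EFinP; apply: measurable_funX; exact: measurableT_comp.
by move=> z; rewrite lee_fin exprn_ge0.
Qed.

Lemma ae_energy_lty : {ae P, forall w, energy w < +oo}.
Proof.
have : P.-integrable setT energy.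
  apply/integrableP; split; first exact: measurable_energy.
  under eq_integral do rewrite gee0_abs ?energy_ge0//.
  exact: phiL2.2.
move/integrable_ae => /(_ measurableT); apply: filterS => w /(_ I).
by rewrite ge0_fin_numE// energy_ge0.
Qed.

(** As |sin| <= 1 and b <= 1 + b^2, the integrand is at most 1 + phi^2, and [0, 1] has length one.
    The bound is uniform in [n] and trivial where the energy is infinite. *)
Lemma sine_coef_le_energy n w :
  `|sine_coef phi n w|%:E <= 2%:E * (1 + energy w).
Proof.
rewrite /sine_coef normrM (ger0_norm (ler0n _ _)) EFinM lee_pmul2l//.
rewrite /Rintegral; set z := integral _ _ _.
(* The real-valued integral is 0 when the extended one is infinite, so its modulus never exceeds
   that of the latter. *)
apply: (@le_trans _ _ `|z|); first by case: z => [r| |]//=; rewrite ?normr0 ?lee_fin ?leey.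
have msin : measurable_fun I01 (fun y : measurableTypeR R => sin (n%:R * pi * y))%R.
  apply: measurable_funTS; apply: continuous_measurable_fun => y.
  apply: continuous_comp; last exact: continuous_sin.
  by apply: mulrl_continuous.
have mI : measurable I01 by exact: measurable_itv.
have mps := measurable_funM (measurable_phi_section w) msin.
apply: (le_trans (le_abse_integral _ _ _)) => //; first exact/measurable_EFinP.
have m2 : measurable_fun I01 (fun y : measurableTypeR R => (`|phi w y| ^+ 2)%:E).
  apply/measurable_EFinP; apply: measurable_funX.
  by apply: measurableT_comp => //; exact: measurable_phi_section.
have -> : 1 + energy w = \int[mu]_(y in `[0%R, 1%R]) (1 + (`|phi w y| ^+ 2)%:E).
  rewrite ge0_integralD//.
  rewrite /energy integral_cst// mul1e; congr (_ + _).
  by rewrite /= lebesgue_measure_itv/= lte01 oppr0 adde0.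
apply: ge0_le_integral => //=.
- by apply/measurable_EFinP; apply: measurableT_comp.
- by apply: emeasurable_funD => //.
- move=> y _; rewrite -EFinD lee_fin normrM.
  have s1 : (`|sin (n%:R * pi * y)| <= 1)%R by rewrite ler_norml sin_geN1 sin_le1.
  have := normr_ge0 (phi w y); have := normr_ge0 (sin (n%:R * pi * y)).
  move: s1; set a := `|sin _|%R; set b := `|phi w y|%R; nra.
Qed.
End energy.

(** * The partial sums *)

Section heat_density.
Local Open Scope ereal_scope.
Context d (T : measurableType d) (R : realType) (P : probability T R).
Local Notation mu := (@lebesgue_measure R).
Variables (x t : R) (alpha2 : T -> R) (A : nat -> T -> R) (fA1 falpha2 : R -> R).
Variables (N : nat) (fA : N.-1.-tuple (measurableTypeR R) -> R).
Hypotheses (x01 : (0 < x < 1)%R) (N2 : (2 <= N)%N).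
Hypothesis AI : independent3 P (alpha2 : T -> measurableTypeR R)
  (A 1%N : T -> measurableTypeR R) (tail_vector A N).
Hypothesis dalpha2 : is_density P mu alpha2 (EFin \o falpha2).
Hypothesis dA1 : is_density P mu (A 1%N) (EFin \o fA1).
Hypothesis dA : is_density P (leb_tuple N.-1) (tail_vector A N) (EFin \o fA).

(** The reciprocal of [heat_mode x t 1], by which u_N - S_N is multiplied to recover A_1. *)
Definition heat_gain (a : R) : R := (expR (pi ^+ 2 * a * t) / sin (pi * x))%R.

Definition heat_tail n (z : n.-1.-tuple (measurableTypeR R) * measurableTypeR R) : R :=
  (\sum_(i < n.-1) tnth z.1 i * heat_mode x t i.+2 z.2)%R.

Lemma sin_pi_gt0 : (0 < sin (pi * x))%R.
Proof.
have := pi_gt0 R; case/andP: x01 => x0 x1 p0.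
by apply: sin_gt0_pi; rewrite mulr_gt0//= gtr_pMr.
Qed.

Lemma heat_gain_gt0 a : (0 < heat_gain a)%R.
Proof. by rewrite divr_gt0 ?expR_gt0// sin_pi_gt0. Qed.

Lemma measurable_heat_mode n : measurable_fun setT (heat_mode x t n : measurableTypeR R -> R).
Proof.
apply: measurable_funM => //; apply: measurableT_comp => //.
apply: measurable_funN; apply: measurable_funM => //.
Qed.

Lemma measurable_heat_gain : measurable_fun setT (heat_gain : measurableTypeR R -> R).
Proof.
apply: measurable_funM => //; apply: measurableT_comp => //.
by apply: measurable_funM => //; exact: measurable_funM.
Qed.

Lemma measurable_heat_tail n : measurable_fun setT (@heat_tail n).
Proof.
apply: measurable_sum => i; apply: measurable_funM.
  exact: (measurableT_comp (measurable_tnth i) measurable_fst).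
exact: (measurableT_comp (measurable_heat_mode _) measurable_snd).
Qed.

Lemma heat_sumE w : heat_sum x t alpha2 A N w =
  (A 1 w / heat_gain (alpha2 w) + heat_tail (tail_vector A N w, alpha2 w))%R.
Proof.
rewrite /heat_sum big_ltn ?ltnS ?(ltnW N2)//; congr (_ + _)%R.
  rewrite /heat_mode /heat_gain invf_div -expRN expr1n !mul1r; congr (_ * _)%R.
  by rewrite mulrC.
(* The modes n = 2, ..., N are renumbered as n = i + 2 with i < N - 1, the indexing of
   [tail_vector]. *)
rewrite /heat_tail/= -{1}(prednK (ltnW N2)) -[2%N]add0n big_addn big_mkord.
have -> : (N.-1.+2 - 2 = N.-1)%N by rewrite subn2.
by apply: eq_bigr => i _; rewrite tnth_mktuple addn2.
Qed.

Let Z w := (tail_vector A N w, alpha2 w : measurableTypeR R).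

Let mZ : measurable_fun setT Z.
Proof.
by have [mA _ _ _] := dA; have [ma _ _ _] := dalpha2; exact: measurable_fun_pair.
Qed.

Let mfA1 : measurable_fun setT fA1.
Proof. by have [_ /measurable_EFinP] := dA1. Qed.

Let fA10 y : (0 <= fA1 y)%R.
Proof. by have [_ _ /(_ y)] := dA1; rewrite lee_fin. Qed.

(** The tail vector and [alpha2] are independent, so the product of their densities is a joint
    density and the integral over R^N is an expectation. *)
Lemma heat_sum_densityE u : heat_sum_density x t fA1 fA falpha2 u =
  \int[P]_w (fA1 (heat_gain (alpha2 w) * (u - heat_tail (Z w))) * heat_gain (alpha2 w))%:E.
Proof.
pose F (z : N.-1.-tuple (measurableTypeR R) * measurableTypeR R) :=
  (fA1 (heat_gain z.2 * (u - @heat_tail N z)) * heat_gain z.2)%:E.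
have mk : measurable_fun setT
    (fun z : N.-1.-tuple (measurableTypeR R) * measurableTypeR R =>
       heat_gain z.2).
  exact: (measurableT_comp measurable_heat_gain measurable_snd).
rewrite -[RHS]/(\int[P]_w F (tail_vector A N w, alpha2 w)).
rewrite (independent_density (F := F) dA dalpha2); last 3 first.
- move=> B C mB mC.
  have := AI mC measurableT mB; rewrite !preimage_setT setIT probability_setT mule1.
  by rewrite setIC muleC.
- apply/measurable_EFinP; apply: measurable_funM => //; apply: (measurableT_comp mfA1).
  apply: measurable_funM => //; apply: measurable_funB => //.
  exact: measurable_heat_tail.
- by move=> z; rewrite lee_fin mulr_ge0// ltW// heat_gain_gt0.
apply: eq_integral => z _; rewrite /F -!EFinM; congr EFin.
rewrite /heat_gain /heat_tail.
ring.
Qed.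

Lemma is_density_heat_sum : is_density P mu (heat_sum x t alpha2 A N)
  (heat_sum_density x t fA1 fA falpha2).
Proof.
have -> : heat_sum_density x t fA1 fA falpha2 = (fun u => \int[P]_w
    (fA1 (heat_gain (Z w).2 * (u - heat_tail (Z w))) *
     heat_gain (Z w).2)%:E).
  by apply/funext => u; rewrite heat_sum_densityE.
have -> : heat_sum x t alpha2 A N =
    (fun w => A 1 w / heat_gain (Z w).2 + heat_tail (Z w))%R.
  by apply/funext => w; rewrite heat_sumE.
apply: (is_density_affine (k := fun z => heat_gain z.2)) => //.
- exact: (measurableT_comp measurable_heat_gain measurable_snd).
- exact: measurable_heat_tail.
- by move=> z; exact: heat_gain_gt0.
- have [ma _ _ _] := dalpha2; have [m1 _ _ _] := dA1; have [mA _ _ _] := dA.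
  exact: (independent3_pair ma m1 mA AI).
Qed.
End heat_density.

(** * Increments of the densities *)

Section heat_increment.
Local Open Scope ereal_scope.
Context d (T : measurableType d) (R : realType) (P : probability T R).
Local Notation mu := (@lebesgue_measure R).
Variables (x t : R) (alpha2 : T -> R) (A : nat -> T -> R) (fA1 falpha2 : R -> R).
Variable fA : forall N : nat, N.-1.-tuple (measurableTypeR R) -> R.
Arguments fA : clear implicits.
Hypothesis x01 : (0 < x < 1)%R.
Hypothesis Ad : forall N : nat, (2 <= N)%N ->
    [/\ independent3 P (alpha2 : T -> measurableTypeR R)
          (A 1%N : T -> measurableTypeR R) (tail_vector A N),
        is_density P mu alpha2 (EFin \o falpha2),
        is_density P mu (A 1%N) (EFin \o fA1) &
        is_density P (leb_tuple N.-1) (tail_vector A N) (EFin \o fA N)].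
Variables (L C : R).
Hypothesis fA1L : forall y z, (`|fA1 y - fA1 z| <= L * `|y - z|)%R.
Hypothesis AC : forall n, (2 <= n)%N -> \int[P]_w (`|A n w|)%:E <= C%:E.

(** Up to sine factors, the squared gain times the n-th mode: the exponents 2 and -n^2 add up,
    whence the n^2 - 2 of the summability assumption. *)
Definition heat_weight n (w : T) : R :=
  expR (- ((n%:R ^+ 2 - 2) * pi ^+ 2 * alpha2 w * t)).

Let K : R := (L / sin (pi * x) ^+ 2)%R.

Lemma lipschitz_const_ge0 : (0 <= L)%R.
Proof.
have := fA1L 0%R 1%R; rewrite sub0r normrN normr1 mulr1.
exact: le_trans.
Qed.

Let K0 : (0 <= K)%R.
Proof. by rewrite divr_ge0 ?lipschitz_const_ge0// exprn_ge0// ltW// sin_pi_gt0. Qed.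

Let malpha2 : measurable_fun setT (alpha2 : T -> measurableTypeR R).
Proof. by have [_ [] ] := Ad (leqnn 2). Qed.

(** For n >= 2, A_n is the last entry of [tail_vector A n], whose measurability is part of having a
    density. *)
Lemma measurable_coef n : (1 <= n)%N -> measurable_fun setT (A n : T -> measurableTypeR R).
Proof.
case: n => // -[_|n _]; first by have [_ _ []] := Ad (leqnn 2).
have [_ _ _ [mA _ _ _]] := Ad (isT : (2 <= n.+2)%N).
have := (measurableT_comp (measurable_tnth (ord_max : 'I_n.+1)) mA).
by apply: eq_measurable_fun => w _; rewrite /= tnth_mktuple.
Qed.

Let measurable_weight n : measurable_fun setT
  (fun a : measurableTypeR R => expR (- ((n%:R ^+ 2 - 2) * pi ^+ 2 * a * t)))%R.
Proof.
apply: measurableT_comp => //; apply: measurable_funN.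
by apply: measurable_funM => //; exact: measurable_funM.
Qed.

(** A_n is independent of [alpha2], so the expectation of the product factorises. *)
Lemma integral_coef_weight n : (2 <= n)%N ->
  \int[P]_w (`|A n w| * heat_weight n w)%:E <= C%:E * \int[P]_w (heat_weight n w)%:E.
Proof.
case: n => [|[|n]]// _.
pose F (z : measurableTypeR R * measurableTypeR R) :=
  (`|z.1| * expR (- ((n.+2%:R ^+ 2 - 2) * pi ^+ 2 * z.2 * t)))%:E.
rewrite -[leLHS]/(\int[P]_w F (A n.+2 w, alpha2 w)).
have mF : measurable_fun setT F.
  apply/measurable_EFinP; apply: measurable_funM.
    by apply: measurableT_comp => //; exact: measurable_fst.
  exact: (measurableT_comp (measurable_weight n.+2) measurable_snd).
have mw : measurable_fun setT (fun w => (heat_weight n.+2 w)%:E).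
  by apply/measurable_EFinP; exact: (measurableT_comp (measurable_weight n.+2) malpha2).
rewrite (independent_integral (X := A n.+2 : T -> measurableTypeR R)
  (Y := alpha2 : T -> measurableTypeR R))//; last 3 first.
- exact: measurable_coef.
- move=> B D mB mD.
  have [AI _ _ _] := Ad (isT : (2 <= n.+2)%N).
  (* An event on A_n is read as one on the tail vector, with A_1 left free, to use the independence
     of the triple. *)
  pose B' := (fun s : n.+1.-tuple (measurableTypeR R) => tnth s ord_max) @^-1` B.
  have mB' : measurable B'.
    by rewrite -[X in measurable X]setTI; exact: measurable_tnth.
  have := AI D setT B' mD measurableT mB'.
  have -> : tail_vector A n.+2 @^-1` B' = A n.+2 @^-1` B.
    by apply/seteqP; split => w; rewrite /B'/= tnth_mktuple.
  by rewrite preimage_setT setIT probability_setT mule1 setIC muleC.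
- by move=> z; rewrite lee_fin mulr_ge0// expR_ge0.
rewrite /F/=.
have -> : \int[P]_w \int[P]_v (`|A n.+2 w| * heat_weight n.+2 v)%:E =
    \int[P]_w (`|A n.+2 w|%:E * \int[P]_v (heat_weight n.+2 v)%:E).
  apply: eq_integral => w _; rewrite -ge0_integralZl//.
  by move=> v _; rewrite lee_fin expR_ge0.
rewrite ge0_integralZr//.
- apply: lee_wpmul2r; last exact: (AC (n := n.+2)).
  by apply: integral_ge0 => v _; rewrite lee_fin expR_ge0.
- by apply/measurable_EFinP; apply: measurableT_comp => //; exact: measurable_coef.
- by apply: integral_ge0 => v _; rewrite lee_fin expR_ge0.
Qed.

Let S N w : R := heat_tail x t (tail_vector A N w, alpha2 w).

(** Two consecutive partial sums share their A_1 term; cancelling it avoids relating tuples of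
    different lengths. *)
Let heat_tailS N w : (2 <= N)%N ->
  S N.+1 w = (S N w + A N.+1 w * heat_mode x t N.+1 (alpha2 w))%R.
Proof.
move=> N2; have := heat_sumE x t alpha2 A (leqW N2) w.
rewrite /heat_sum big_nat_recr//= -/(heat_sum x t alpha2 A N w).
rewrite (heat_sumE x t alpha2 A N2).
by rewrite -addrA => /addrI.
Qed.

Let gain_mode N w :
  (heat_gain x t (alpha2 w) ^+ 2 * `|heat_mode x t N (alpha2 w)| <=
   heat_weight N w / sin (pi * x) ^+ 2)%R.
Proof.
rewrite /heat_gain /heat_mode /heat_weight normrM (ger0_norm (expR_ge0 _)).
rewrite expr_div_n -expRM_natl mulrAC ler_wpM2r ?invr_ge0 ?exprn_ge0 ?(ltW (sin_pi_gt0 x01))//.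
rewrite [leLHS]mulrA -expRD.
have -> : (2 * (pi ^+ 2 * alpha2 w * t) + - (N%:R ^+ 2 * pi ^+ 2 * alpha2 w * t) =
  - ((N%:R ^+ 2 - 2) * pi ^+ 2 * alpha2 w * t) :> R)%R by ring.
by rewrite ler_piMr ?expR_ge0// ler_norml sin_geN1 sin_le1.
Qed.

Let X N u w : R := (fA1 (heat_gain x t (alpha2 w) * (u - S N w)) * heat_gain x t (alpha2 w))%R.

(** The squared gain has two origins: one factor is the Jacobian, the other multiplies u - S_N
    inside the Lipschitz function. *)
Let integrand_dist N u w : (2 <= N)%N ->
  (`|X N.+1 u w - X N u w| <= K * (`|A N.+1 w| * heat_weight N.+1 w))%R.
Proof.
move=> N2; rewrite /X heat_tailS//.
have k0 := heat_gain_gt0 t x01 (alpha2 w).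
rewrite -mulrBl normrM (gtr0_norm k0).
apply: (@le_trans _ _ (L *
    `|heat_gain x t (alpha2 w) * (A N.+1 w * heat_mode x t N.+1 (alpha2 w))| *
    heat_gain x t (alpha2 w))%R).
  rewrite ler_wpM2r ?(ltW k0)//; apply: (le_trans (fA1L _ _)).
  rewrite -mulrBr (_ : u - _ - _ = - (A N.+1 w * heat_mode x t N.+1 (alpha2 w)))%R.
    by rewrite mulrN normrN.
  by ring.
rewrite (normrM (heat_gain x t (alpha2 w))) (normrM (A N.+1 w)) (gtr0_norm k0).
have := ler_wpM2l (mulr_ge0 lipschitz_const_ge0 (normr_ge0 (A N.+1 w)))
  (gain_mode N.+1 w).
rewrite /K => H; apply: le_trans (le_trans H _).
  by rewrite le_eqVlt; apply/orP; left; apply/eqP; ring.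
by rewrite le_eqVlt; apply/orP; left; apply/eqP; ring.
Qed.

Definition increment_bound N := (K * C)%:E * \int[P]_w (heat_weight N w)%:E.
Let fu N := heat_sum_density x t fA1 (fA N) falpha2.
Let fuE N u : (2 <= N)%N -> fu N u = \int[P]_w (X N u w)%:E.
Proof.
by move=> N2; have [AI da d1 dA] := Ad N2; rewrite /fu (heat_sum_densityE t x01 AI da d1 dA).
Qed.

(** The form is additive because both integrals may be infinite. *)
Let integral_le (X1 X2 Y : T -> R) (b : \bar R) :
  measurable_fun setT X1 -> measurable_fun setT X2 -> measurable_fun setT Y ->
  (forall w, 0 <= X1 w)%R -> (forall w, 0 <= X2 w)%R -> (forall w, 0 <= Y w)%R ->
  (forall w, `|X1 w - X2 w| <= Y w)%R -> \int[P]_w (Y w)%:E <= b ->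
  \int[P]_w (X1 w)%:E <= \int[P]_w (X2 w)%:E + b.
Proof.
move=> m1 m2 mY X10 X20 Y0 X12 Yb.
apply: (@le_trans _ _ (\int[P]_w ((X2 w)%:E + (Y w)%:E))); last first.
  rewrite ge0_integralD//; try exact/measurable_EFinP.
  - exact: leeD2l.
  - by move=> w _; rewrite lee_fin.
  - by move=> w _; rewrite lee_fin.
apply: ge0_le_integral => //.
- by move=> w _; rewrite lee_fin.
- exact/measurable_EFinP.
- by apply/measurable_EFinP; exact: measurable_funD.
by move=> w _; rewrite -EFinD lee_fin; have := ler_norm (X1 w - X2 w); have := X12 w; lra.
Qed.

Let mX N u : (2 <= N)%N -> measurable_fun setT (X N u).
Proof.
move=> N2; have [AI da [_ /measurable_EFinP mf1 _ _] [mA _ _ _]] := Ad N2.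
have mk := measurableT_comp (measurable_heat_gain x t) malpha2.
apply: measurable_funM => //; apply: (measurableT_comp mf1).
apply: measurable_funM => //; apply: measurable_funB => //.
exact: (measurableT_comp (@measurable_heat_tail R x t N) (measurable_fun_pair mA malpha2)).
Qed.

Let X0 N u w : (0 <= X N u w)%R.
Proof.
have [_ _ [_ _ f0 _] _] := Ad (leqnn 2).
rewrite mulr_ge0//; last by rewrite ltW// heat_gain_gt0.
by have := f0 (heat_gain x t (alpha2 w) * (u - S N w))%R; rewrite lee_fin.
Qed.

Lemma heat_sum_density_increment N u : (2 <= N)%N ->
  fu N.+1 u <= fu N u + increment_bound N.+1 /\
  fu N u <= fu N.+1 u + increment_bound N.+1.
Proof.
move=> N2; have N2' := leqW N2; rewrite !fuE//.
pose Y w := (K * (`|A N.+1 w| * heat_weight N.+1 w))%R.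
have mAw : measurable_fun setT (fun w => `|A N.+1 w| * heat_weight N.+1 w)%R.
  apply: measurable_funM; first by apply: measurableT_comp => //; exact: measurable_coef.
  exact: (measurableT_comp (measurable_weight N.+1) malpha2).
have mY : measurable_fun setT Y by exact: measurable_funM.
have Aw0 w : (0 <= `|A N.+1 w| * heat_weight N.+1 w)%R by rewrite mulr_ge0// expR_ge0.
have Y0 w : (0 <= Y w)%R by rewrite mulr_ge0.
have Yb : \int[P]_w (Y w)%:E <= increment_bound N.+1.
  under eq_integral do rewrite EFinM.
  rewrite ge0_integralZl//; last 2 first.
  - exact/measurable_EFinP.
  - by move=> w _; rewrite lee_fin.
  rewrite /increment_bound (EFinM K C) -muleA lee_wpmul2l ?lee_fin//.
  exact: integral_coef_weight.
split; apply: (integral_le _ _ mY) => //; try exact: mX.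
- by move=> w; exact: integrand_dist.
- by move=> w; rewrite distrC; exact: integrand_dist.
Qed.
End heat_increment.

(** * Convergence *)

(** With b = pi^2 alpha^2 t > 0, the terms are dominated by a geometric series of ratio e^(-b),
    since n <= (n + 1)^2. *)
Lemma cvg_heat_sum d (T : measurableType d) (R : realType) (x t : R) (alpha2 : T -> R)
    (A : nat -> T -> R) (w : T) (C : R) :
  0 < t -> 0 < alpha2 w -> (forall n, `|A n w| <= C) ->
  cvgn (fun N => heat_sum x t alpha2 A N w).
Proof.
move=> t0 a0 AC.
have C0 : 0 <= C := le_trans (normr_ge0 _) (AC 0).
pose b := pi ^+ 2 * alpha2 w * t.
have b0 : 0 < b by rewrite !mulr_gt0 ?exprn_gt0 ?pi_gt0.
pose q := expR (- b).
have q1 : `|q| < 1 by rewrite ger0_norm ?expR_ge0// -expR0 ltr_expR oppr_lt0.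
pose v n := A n.+1 w * heat_mode x t n.+1 (alpha2 w).
have -> : (fun N => heat_sum x t alpha2 A N w) = series v.
  by apply/funext => N; rewrite /heat_sum big_add1.
apply: normed_cvg; apply: (series_le_cvg (v_ := geometric C q)).
- by move=> n; exact: normr_ge0.
- by move=> n; rewrite mulr_ge0// exprn_ge0// expR_ge0.
- move=> n; rewrite /= /v normrM /heat_mode normrM (ger0_norm (expR_ge0 _)) /=.
  apply: ler_pM; [exact: normr_ge0|by rewrite mulr_ge0// expR_ge0|exact: AC|].
  apply: (@le_trans _ _ (expR (- (n.+1%:R ^+ 2 * b)))).
    rewrite /b !mulrA ler_piMr ?expR_ge0//.
    by rewrite ler_norml sin_geN1 sin_le1.
  rewrite /q -expRM_natl ler_expR mulrN lerN2 ler_wpM2r ?(ltW b0)//.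
  by rewrite -natrX ler_nat expnS expn1 (leq_trans (leqnSn n))// leq_pmulr.
- exact: is_cvg_geometric_series.
Qed.
Theorem theorem2p8 (d : measure_display) (T : measurableType d) (R : realType)
    (P : probability T R) (x t : R) (phi : T -> R -> R) (alpha2 : T -> R)
    (fA1 falpha2 : R -> R)
    (fA : forall N : nat, N.-1.-tuple (measurableTypeR R) -> R) (m : nat) :
  measure_is_complete P ->
  0 < x < 1 -> 0 < t ->
  L2_process P phi ->
  {ae P, forall w, 0 < alpha2 w} ->
  let A := sine_coef phi in
  (forall N : nat, (2 <= N)%N ->
    [/\ independent3 P (alpha2 : T -> measurableTypeR R)
          (A 1%N : T -> measurableTypeR R) (tail_vector A N),
        is_density P lebesgue_measure alpha2 (EFin \o falpha2),
        is_density P lebesgue_measure (A 1%N) (EFin \o fA1) &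
        is_density P (leb_tuple N.-1) (tail_vector A N) (EFin \o fA N)]) ->
  [lipschitz fA1 y | y in [set: R]] ->
  (\sum_(m <= n <oo)
     'N[P]_1[(fun w =>
        (expR (- ((n%:R ^+ 2 - 2) * pi ^+ 2 * alpha2 w * t)))%:E)]
   < +oo)%E ->
  let fu N := heat_sum_density x t fA1 (fA N) falpha2 in
  [/\ forall N : nat, (2 <= N)%N ->
        is_density P lebesgue_measure (heat_sum x t alpha2 A N) (fu N),
      {ae P, forall w, cvgn (fun N => heat_sum x t alpha2 A N w)} &
      exists g : R -> R,
        is_density P lebesgue_measure (heat_solution x t alpha2 A) (EFin \o g) /\
        ('N[lebesgue_measure]_+oo[(fun v => fu N v - (g v)%:E)] @[N --> \oo]
           --> 0)%E].
Proof.
move=> cP x01 t0 phiL2 a0 A Ad fAlip Noo fu.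
have AC n w := sine_coef_le_energy phiL2 n w.
have eoo := ae_energy_lty phiL2.
have cvgae : {ae P, forall w, cvgn (fun N => heat_sum x t alpha2 A N w)}.
  apply: filterS2 eoo a0 => w ew aw.
  (* Where the energy is finite, it bounds all the coefficients at once. *)
  apply: (@cvg_heat_sum _ _ _ _ _ _ _ _ (2 * (1 + fine (energy phi w)))) => // n.
  rewrite -lee_fin; apply: (le_trans (AC n w)).
  by rewrite EFinM (EFinD 1 (fine _)) fineK // ge0_fin_numE // energy_ge0.
have dfu N : (2 <= N)%N -> is_density P lebesgue_measure (heat_sum x t alpha2 A N) (fu N).
  move=> N2; have [AI da d1 dA] := Ad N N2.
  exact: (is_density_heat_sum t x01 N2 AI da d1 dA).
split => //.
(* The Lipschitz property is a bound by all large enough constants; a positive one is extracted. *)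
have [L _ fA1L] : exists2 L, 0 < L & forall y z, `|fA1 y - fA1 z| <= L * `|y - z|.
  have [L L0 fL] := pinfty_ex_gt0 fAlip.
  by exists L => // y z; exact: (fL (y, z) (conj I I)).
(* The expectation of 2 (1 + energy), which bounds every E|A_n|. *)
pose C : R := 2 * (1 + fine (\int[P]_w energy phi w)%E).
have CE : (C%:E = 2%:E * (1 + \int[P]_w energy phi w))%E.
  rewrite /C EFinM (EFinD 1 (fine _)) fineK// ge0_fin_numE; first exact: phiL2.2.
  by apply: integral_ge0 => w _; exact: energy_ge0.
have C0 : 0 <= C.
  rewrite mulr_ge0// addr_ge0// fine_ge0//.
  by apply: integral_ge0 => w _; exact: energy_ge0.
have intAC n : (2 <= n)%N -> (\int[P]_w (`|A n w|)%:E <= C%:E)%E.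
  move=> n2.
  have mA := measurable_coef Ad (ltnW n2).
  have me := measurable_energy phiL2.
  have e0 := @energy_ge0 _ T R phi.
  have -> : (C%:E = \int[P]_w (2%:E * (1 + energy phi w)))%E.
    rewrite ge0_integralZl//; last 2 first.
    - exact: emeasurable_funD.
    - by move=> w _; rewrite adde_ge0.
    by rewrite ge0_integralD// integral_cst// mul1e CE -(probability_setT P).
  apply: ge0_le_integral => //.
  - by apply/measurable_EFinP; exact: measurableT_comp.
  - by apply: emeasurable_funM => //; exact: emeasurable_funD.
(* The sequence starts at an index at least 2, where the hypotheses on the tail vector hold, and at
   least [m], where the series of weights begins. *)
pose N0 := maxn 2 m.
(* The successor appears because the step from N to N + 1 is governed by the new mode N + 1. *)
pose c n := increment_bound P x t alpha2 L C (n + N0).+1.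
pose V := heat_solution x t alpha2 A.
pose U n := heat_sum x t alpha2 A (n + N0).
have N02 n : (2 <= n + N0)%N by rewrite (leq_trans (leq_maxl 2 m))// leq_addl.
have UV : {ae P, forall w, U n w @[n --> \oo] --> V w}.
  apply: filterS cvgae => w cw.
  by rewrite /U (cvg_shiftn N0 (fun N => heat_sum x t alpha2 A N w)).
have mU n : measurable_fun setT (U n : T -> measurableTypeR R).
  by have [] := dfu _ (N02 n).
(* [V] takes a default value where the series diverges. It equals a measurable lower limit almost
   everywhere, and completeness of [P] transfers measurability. *)
have mV : measurable_fun setT (V : T -> measurableTypeR R).
  apply/measurable_EFinP.
  apply: (@ae_measurable_fun _ _ _ _ cP _ (fun w => limn_einf (fun n => (U n w)%:E))).
    apply: filterS UV => w Uw _.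
    have UE : (U n w)%:E @[n --> \oo] --> (V w)%:E.
      by apply: cvg_EFin; [exact: nearW|exact: Uw].
    by have [-> _] := cvg_limn_einf_sup UE.
  apply: measurable_fun_limn_einf => n; apply/measurable_EFinP; exact: mU.
have w0 n w : (0 <= (heat_weight t alpha2 n w)%:E :> \bar R)%E by rewrite lee_fin expR_ge0.
have iw0 n : (0 <= \int[P]_w (heat_weight t alpha2 n w)%:E)%E by exact: integral_ge0.
have K0 : 0 <= L / sin (pi * x) ^+ 2 * C.
  rewrite mulr_ge0// divr_ge0// ?(lipschitz_const_ge0 fA1L)//.
  by rewrite exprn_ge0// ltW// sin_pi_gt0.
have c0 n : (0 <= c n)%E by rewrite mule_ge0.
have coo : (\sum_(0 <= k <oo) c k < +oo)%E.
  (* Up to a finite constant, this is the sum of the expected weights from [N0.+1] on, a tail of the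
     series assumed to converge. *)
  rewrite nneseriesZl//; apply: lte_mul_pinfty => //.
  under eq_eseriesr do rewrite -addnS.
  rewrite (nneseries_addn (f := fun i => \int[P]_w (heat_weight t alpha2 i w)%:E)%E)//.
  apply: le_lt_trans Noo.
  have mN0 : (m <= N0.+1)%N by rewrite (leq_trans (leq_maxr 2 m)).
  rewrite [leRHS](eq_eseriesr
    (g := fun i => \int[P]_w (heat_weight t alpha2 i w)%:E)%E); last first.
    by move=> i _; rewrite Lnorm1; apply: eq_integral => w _; rewrite gee0_abs.
  rewrite [leRHS](nneseries_split m (N0.+1 - m))// subnKC// leeDr// sume_ge0//.
have inc n u := heat_sum_density_increment t x01 Ad fA1L intAC u (N02 n).
have [g [dg cg]] := density_limit (U := U) (f := fun n => fu (n + N0)%N)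
  (fun n => dfu _ (N02 n)) mV UV c0 coo
  (fun n u => (inc n u).1) (fun n u => (inc n u).2).
exists g; split => //.
by move: cg; rewrite (cvg_shiftn N0 (fun N =>
  'N[lebesgue_measure]_+oo[(fun v => fu N v - (g v)%:E)]%E)).
Qed.
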